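(* Let $A$ be an $n$-dimensional perfect evolution algebra over a field $\mathbb K$, $n\geq 3$, and assume that there exists a maximal $s$-basic ideal $I$ of $A$ with $s\in\{1,n/2\}$ ($n$ being even in the last case). Then there exists a natural basis $B=\{e_1,\dots,e_n\}$ of $A$ such that $I$ is the ideal generated by $\{e_1,\dots,e_s\}$ and $$M_B=\begin{pmatrix} W & U\\ 0 & Y\end{pmatrix},$$ where $W\in M_s(\mathbb K)$ is the structure matrix of $I$ relative to $\{e_1,\dots,e_s\}$, $U\in M_{s\times(n-s)}(\mathbb K)$ and $Y\in M_{n-s}(\mathbb K)$. For $\sigma\in S_n$ write $B^\sigma=\{e_{\sigma(1)},\dots,e_{\sigma(n)}\}$ (as an ordered basis). Moreover, for such a $B$: (i) If $s=1$, then $A$ is irreducible, and every $\sigma\in S_n$ such that $M_{B^\sigma}$ has the same block form as $M_B$ (zero lower-left $(n-1)\times 1$ block) satisfies $\sigma(1)=1$. (ii) If $s=1$, then the number of zeros in $W$, in $U$ and in $Y$ is invariant. (iii) If $s=n/2$ and $A$ is irreducible, then every $\sigma\in S_n$ such that $M_{B^\sigma}$ has the same block form as $M_B$ (zero lower-left $\frac n2\times\frac n2$ block) satisfies $\sigma(i)\in\{1,\dots,n/2\}$ for all $i\in\{1,\dots,n/2\}$ (and consequently $\sigma(j)\in\{(n/2)+1,\dots,n\}$ for all $j\in\{(n/2)+1,\dots,n\}$). (iv) If $s=n/2$ and $A$ is irreducible, then the number of zeros in $W$, in $U$ and in $Y$ is invariant. This conclusion can fail when $A$ is not irreducible: if $\mathbb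 K$ has characteristic different from $2$, there exist an even $n\ge 3$, a perfect reducible $n$-dimensional evolution algebra $A$ over $\mathbb K$ with a maximal $n/2$-basic ideal $I$, and a natural basis $B=\{e_1,\dots,e_n\}$ of $A$ such that $I$ is the ideal generated by $\{e_1,\dots,e_{n/2}\}$ and $M_B=\begin{pmatrix} W & U\\ 0 & Y\end{pmatrix}$ with $W,U,Y\in M_{n/2}(\mathbb K)$ and $W$ the structure matrix of $I$ relative to $\{e_1,\dots,e_{n/2}\}$, for which the numbers of zeros in $W$, $U$, $Y$ are not all invariant.
   Context: An evolution algebra over a field $\mathbb K$ is a (not necessarily associative) $\mathbb K$-algebra $A$ having a basis $B=\{e_i \mid i\in\Lambda\}$ with $e_ie_j=0$ whenever $i\neq j$; such a basis is called a natural basis. Writing $e_i^2=\sum_k\omega_{ki}e_k$, the matrix $M_B=(\omega_{ki})$ (column $i$ holds the coordinates of $e_i^2$) is the structure matrix of $A$ relative to the (ordered) basis $B$. $A$ is perfect if $A^2=A$, where $A^2$ is the linear span of all products. $A$ is reducible if it is the direct sum of two nonzero ideals, and irreducible otherwise. A nonzero proper ideal $I$ of $A$ is an $i$-basic ideal relative to a natural basis $B$ if $I$ is the linear span of $i$ vectors of $B$ (so $\dim I=i$); a basic ideal relative to $B$ is an ideal that is $i$-basic relative to $B$ for some $i$. $I$ is a maximal $i$-basic ideal relative to $B$ if it is $i$-basic relative to $B$ and there are no basic ideals relative to $B$ of dimension $j>i$. For a perfect finite-dimensional $A$, $I$ is called a (maximal) $i$-basic ideal if it is so relative to every natural basis of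 $A$ (for such $A$ these notions do not depend on the natural basis). Invariance of the number of zeros: given an ordered natural basis $B$ with $M_B=\begin{pmatrix} W & U\\ 0 & Y\end{pmatrix}$, the number of zeros of $W$ is invariant if for every ordered natural basis $B'$ of $A$ with $M_{B'}=\begin{pmatrix} W' & U'\\ 0 & Y'\end{pmatrix}$ (blocks of the same sizes as those of $M_B$), the number of zero entries of $W'$ equals the number of zero entries of $W$; invariance for $U$ and for $Y$ is defined analogously. *)

(* Defs.v *)
From HB Require Import structures.
From mathcomp Require Import all_boot all_order all_fingroup all_algebra.

Set Implicit Arguments.
Unset Strict Implicit.
Unset Printing Implicit Defensive.

Import GRing.Theory.
Local Open Scope ring_scope.

(* A finite-dimensional, not necessarily associative, algebra over K is a      *)
(* carrier A : vectType K together with a product mul : {bilinear A -> A -> A}. *)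

Section EvolutionAlgebra.
Variables (K : fieldType) (A : vectType K) (mul : {bilinear A -> A -> A}).

(* The subspace U is a parameter so that the same notion applies to the whole  *)
(* algebra (U = {:A}) and to an ideal seen as an evolution algebra (U = I).    *)
Definition natural_basis (U : {vspace A}) (n : nat) (B : n.-tuple A) : Prop :=
  basis_of U B /\
  forall i j : 'I_n, i != j -> mul (tnth B i) (tnth B j) = 0.

Definition evolution_algebra : Prop :=
  exists (n : nat) (B : n.-tuple A), natural_basis {:A} B.

(* Column i holds the coordinates of e_i^2. Since coord only refers to B, this *)
(* is meaningful as soon as B is a natural basis of a subspace closed under    *)
(* mul, in particular of an ideal.                                             *)
Definition structure_mx (n : nat) (B : n.-tuple A) : 'M[K]_n :=
  \matrix_(k, i) coord B k (mul (tnth B i) (tnth B i)).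

(* A = A^2: every element lies in the span of finitely many products.          *)
Definition perfect : Prop :=
  forall x : A, exists s : seq (A * A),
    x \in <<[seq mul p.1 p.2 | p <- s]>>%VS.

Definition is_ideal (I : {vspace A}) : Prop :=
  forall a x : A, x \in I -> mul a x \in I /\ mul x a \in I.

Definition reducible : Prop :=
  exists I J : {vspace A},
    [/\ is_ideal I /\ is_ideal J, I != 0%VS, J != 0%VS,
        (I + J)%VS = {:A}%VS & directv (I + J)].

Definition irreducible : Prop := ~ reducible.

Definition ideal_generated_by (I : {vspace A}) (X : seq A) : Prop :=
  [/\ is_ideal I, {subset X <= I} &
      forall J : {vspace A}, is_ideal J -> {subset X <= J} -> (I <= J)%VS].

Definition basic_ideal_rel (n : nat) (B : n.-tuple A) (i : nat)
    (I : {vspace A}) : Prop :=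
  [/\ is_ideal I, I != 0%VS, I != {:A}%VS &
      exists S : {set 'I_n},
        #|S| = i /\ I = <<[seq tnth B k | k in S]>>%VS].

Definition maximal_basic_ideal_rel (n : nat) (B : n.-tuple A) (i : nat)
    (I : {vspace A}) : Prop :=
  basic_ideal_rel B i I /\
  forall (j : nat) (J : {vspace A}), (i < j)%N -> ~ basic_ideal_rel B j J.

Definition maximal_basic_ideal (i : nat) (I : {vspace A}) : Prop :=
  forall (n : nat) (B : n.-tuple A),
    natural_basis {:A} B -> maximal_basic_ideal_rel B i I.

Definition first_tuple (s m : nat) (B : (s + m).-tuple A) : s.-tuple A :=
  [tuple tnth B (lshift m i) | i < s].

Definition permuted_basis (n : nat) (B : n.-tuple A) (sigma : 'S_n) :
    n.-tuple A :=
  [tuple tnth B (sigma i) | i < n].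

Definition block_basis (s m : nat) (B : (s + m).-tuple A)
    (W : 'M[K]_s) (U : 'M[K]_(s, m)) (Y : 'M[K]_m) : Prop :=
  natural_basis {:A} B /\ structure_mx B = block_mx W U 0 Y.

Definition adapted_basis (s m : nat) (I : {vspace A}) (B : (s + m).-tuple A)
    (W : 'M[K]_s) (U : 'M[K]_(s, m)) (Y : 'M[K]_m) : Prop :=
  [/\ block_basis B W U Y,
      ideal_generated_by I (first_tuple B),
      natural_basis I (first_tuple B) &
      W = structure_mx (first_tuple B)].

Definition num_zeros (p q : nat) (M : 'M[K]_(p, q)) : nat :=
  #|[set ij : 'I_p * 'I_q | M ij.1 ij.2 == 0]|.

Definition zeros_invariant (s m : nat)
    (W : 'M[K]_s) (U : 'M[K]_(s, m)) (Y : 'M[K]_m) : Prop :=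
  [/\ forall (B' : (s + m).-tuple A) W' U' Y',
        block_basis B' W' U' Y' -> num_zeros W' = num_zeros W,
      forall (B' : (s + m).-tuple A) W' U' Y',
        block_basis B' W' U' Y' -> num_zeros U' = num_zeros U
    & forall (B' : (s + m).-tuple A) W' U' Y',
        block_basis B' W' U' Y' -> num_zeros Y' = num_zeros Y].

End EvolutionAlgebra.

(* Main.v *)
Require Import Defs.
From HB Require Import structures.
From mathcomp Require Import all_boot all_order all_fingroup all_algebra.

Set Implicit Arguments.
Unset Strict Implicit.
Unset Printing Implicit Defensive.

Import GRing.Theory.
Local Open Scope ring_scope.

(** Everything rests on a rigidity property: in a perfect evolution algebra, any
    two natural bases agree up to a permutation and a nonzero rescaling of their
    vectors [natural_basis_unique].  Indeed A = A^2 forces the n squares e_i^2 to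
    be linearly independent; if two vectors of another natural basis both had
    a nonzero coordinate along e_i, their product, which is 0, would have
    a nonzero coefficient along e_i^2.  Hence the structure matrix is determined
    up to simultaneous permutation of rows and columns and multiplication of its
    entries by nonzero scalars [structure_mx_rescaled].

    With respect to a fixed natural basis, questions on ideals become questions
    on sets of indices.  The span of the e_i with i in S is an ideal exactly when
    S is closed, meaning that the columns of M indexed by S vanish outside of S
    [span_on_ideal].  A zero lower-left block says that the set F of the first s
    indices is closed, and A is reducible exactly when some nontrivial closed
    set has a closed complement [reducibleE].

    The core is then a counting argument [maximal_closed_unique].  A union of
    closed sets is closed, so by maximality of s two different closed sets S, T
    with s elements must cover all n indices.  For s = 1 this contradicts
    n > 2; for s = n/2 it makes T the complement of S, so A is reducible.
    Thus, in the situations considered, F is the only closed set with s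
    elements: a permutation which preserves the block form must stabilise F, and
    it permutes the zeros inside each of the three blocks.  For s = 1, A is
    irreducible because both summands of a decomposition would have dimension at
    most 1 [maximal1_irreducible].

    In the reducible case, take the direct sum of two 2-dimensional algebras with
    structure matrices (0 1; 1 0) and (1 1; 1 0).  Swapping the two summands
    keeps the block form but exchanges blocks with 2 zeros and with 1 zero. *)

(** * Subfamilies and rescalings of a basis *)

Section Bases.
Variables (K : fieldType) (A : vectType K) (n : nat).
Implicit Types (B : n.-tuple A) (S T : {set 'I_n}) (sigma : 'S_n).

Definition span_on B S : {vspace A} := <<[seq tnth B k | k in S]>>%VS.

Definition rescaled_basis B sigma (c : 'I_n -> K) : n.-tuple A :=
  [tuple c i *: tnth B (sigma i) | i < n].

Lemma permuted_basisE B sigma :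
  permuted_basis B sigma = rescaled_basis B sigma (fun=> 1).
Proof. by apply: eq_from_tnth => i; rewrite !tnth_mktuple scale1r. Qed.

Lemma coord_tnth B i j : basis_of {:A} B -> coord B i (tnth B j) = (i == j)%:R.
Proof.
by move=> /basis_free freeB; rewrite (tnth_nth 0) coord_free // eq_sym.
Qed.

Lemma coordE B x : basis_of {:A} B -> x = \sum_i coord B i x *: tnth B i.
Proof.
move=> basisB; rewrite {1}(coord_basis basisB (memvf x)).
by apply: eq_bigr => i _; rewrite (tnth_nth 0).
Qed.

Lemma coord_sum_tnth B (a : 'I_n -> K) k :
  basis_of {:A} B -> coord B k (\sum_i a i *: tnth B i) = a k.
Proof.
move=> /basis_free freeB; rewrite -[RHS](coord_sum_free a k freeB).
by congr (coord B k _); apply: eq_bigr => i _; rewrite (tnth_nth 0).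
Qed.

Lemma tnth_neq0 B i : basis_of {:A} B -> tnth B i != 0.
Proof. by move=> /basis_not0 B0; apply: B0; apply: mem_tnth. Qed.

Lemma mem_span_on B S x :
    basis_of {:A} B ->
  reflect (forall k, k \notin S -> coord B k x = 0) (x \in span_on B S).
Proof.
move=> basisB; apply: (iffP idP) => [xS k kS | x0].
  have /subvP/(_ _ xS) : (span_on B S <= lker (linfun (coord B k : A -> K^o)))%VS.
    apply/span_subvP => _ /imageP[i iS ->].
    rewrite memv_ker lfunE /= coord_tnth //.
    by case: (k =P i) => [ki | _]; [rewrite ki iS in kS | rewrite eqxx].
  by rewrite memv_ker lfunE => /eqP.
rewrite (coordE x basisB); apply: memv_suml => i _.
have [iS | /x0 ->] := boolP (i \in S); last by rewrite scale0r mem0v.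
by apply/memvZ/memv_span/image_f.
Qed.

Lemma tnth_span_on B S i :
  basis_of {:A} B -> (tnth B i \in span_on B S) = (i \in S).
Proof.
move=> basisB; apply/(mem_span_on _ _ basisB)/idP => [h | iS k kS].
  apply: contraT => /h; rewrite coord_tnth // eqxx => /eqP.
  by rewrite oner_eq0.
by rewrite coord_tnth //; case: eqP => // ki; rewrite ki iS in kS.
Qed.

Lemma span_on_inj B : basis_of {:A} B -> injective (span_on B).
Proof.
by move=> basisB S T ST; apply/setP=> i; rewrite -!(tnth_span_on _ _ basisB) ST.
Qed.

Lemma span_on0 B : basis_of {:A} B -> span_on B set0 = 0%VS.
Proof.
move=> basisB; apply/eqP; rewrite -subv0; apply/span_subvP=> x /imageP[i].
by rewrite inE.
Qed.

Lemma span_onT B : basis_of {:A} B -> span_on B setT = {:A}%VS.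
Proof.
move=> basisB; apply/vspaceP=> x; rewrite memvf; apply/(mem_span_on _ _ basisB).
by move=> k; rewrite inE.
Qed.

(** Rescaling moves no line spanned by a basis vector, so only the permutation of
    the indices is visible on the spans of subfamilies. *)
Lemma span_on_rescaled B sigma c S :
    (forall i, c i != 0) ->
  span_on (rescaled_basis B sigma c) S = span_on B (sigma @: S).
Proof.
move=> c0; apply: subv_anti; apply/andP; split; apply/span_subvP.
  move=> _ /imageP[i iS ->]; rewrite tnth_mktuple.
  by apply/memvZ/memv_span/image_f/imset_f.
move=> _ /imageP[_ /imsetP[i iS ->] ->].
rewrite -[tnth _ _](scalerK (c0 i)); apply/memvZ/memv_span.
by apply/imageP; exists i; rewrite // tnth_mktuple.
Qed.

End Bases.

(** * Natural bases and closed sets of indices *)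

Section Evolution.
Variables (K : fieldType) (A : vectType K) (mul : {bilinear A -> A -> A}).
Variable n : nat.
Implicit Types (B : n.-tuple A) (S T : {set 'I_n}) (sigma : 'S_n).

(** Viewing M as a digraph with an arrow from i to k when M k i != 0, these are
    the sets that no arrow leaves. *)
Definition mx_closed p (M : 'M[K]_p) (S : {set 'I_p}) : Prop :=
  forall i k, i \in S -> k \notin S -> M k i = 0.

(** Multiplying by a basis vector extracts a coordinate; this is how ideals are
    related to coordinates below. *)
Lemma mul_tnthr B x j :
    natural_basis mul {:A} B ->
  mul x (tnth B j) = coord B j x *: mul (tnth B j) (tnth B j).
Proof.
move=> [basisB orthB]; rewrite {1}(coordE x basisB) linear_sumlz (bigD1 j) //=.
rewrite linearZl_LR /= big1 ?addr0 // => i ij.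
by rewrite linearZl_LR /= orthB // scaler0.
Qed.

Lemma mul_coordE B x y :
    natural_basis mul {:A} B ->
  mul x y =
    \sum_i (coord B i x * coord B i y) *: mul (tnth B i) (tnth B i).
Proof.
move=> natB; rewrite {1}(coordE y natB.1) linear_sumr.
apply: eq_bigr => i _.
by rewrite linearZr_LR /= (mul_tnthr _ _ natB) scalerA mulrC.
Qed.

Lemma square_tnth B i :
    natural_basis mul {:A} B ->
  mul (tnth B i) (tnth B i) = \sum_k structure_mx mul B k i *: tnth B k.
Proof.
move=> natB; rewrite {1}(coordE (mul _ _) natB.1).
by apply: eq_bigr => k _; rewrite mxE.
Qed.

Lemma span_on_ideal B S :
    natural_basis mul {:A} B ->
  is_ideal mul (span_on B S) <-> mx_closed (structure_mx mul B) S.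
Proof.
move=> natB; have [basisB _] := natB; split=> [idS i k iS kS | closedS a x].
  have [] := idS (tnth B i) (tnth B i); first by rewrite tnth_span_on.
  by move=> /(mem_span_on _ _ basisB)/(_ k kS) + _; rewrite mxE.
move=> /(mem_span_on _ _ basisB) xS.
split; rewrite (mul_coordE _ _ natB); apply: memv_suml => i _.
  have [iS | /xS ->] := boolP (i \in S); last by rewrite mulr0 scale0r mem0v.
  apply/memvZ/(mem_span_on _ _ basisB) => k /(closedS i) <- //.
  by rewrite mxE.
have [iS | /xS ->] := boolP (i \in S); last by rewrite mul0r scale0r mem0v.
apply/memvZ/(mem_span_on _ _ basisB) => k /(closedS i) <- //.
by rewrite mxE.
Qed.

Lemma basic_ideal_relE B i I :
    natural_basis mul {:A} B ->
  basic_ideal_rel mul B i I <->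
  exists S, [/\ mx_closed (structure_mx mul B) S, #|S| = i, (0 < i < n)%N
              & I = span_on B S].
Proof.
move=> natB; have [basisB _] := natB; split=> [[idI I0 I1 [S [Si IS]]] | [S]].
  exists S; split => //; first by apply/(span_on_ideal _ natB); rewrite -[span_on _ _]IS.
  have leSn : (#|S| <= n)%N by rewrite -[leqRHS]card_ord max_card.
  rewrite -Si lt0n cards_eq0 ltn_neqAle leSn andbT.
  apply/andP; split.
    by apply: contra I0 => /eqP S0; rewrite IS S0; apply/eqP/span_on0.
  apply: contra I1 => /eqP Sn; apply/eqP; rewrite IS; transitivity (span_on B S) => //.
  rewrite (_ : S = setT) ?span_onT //; apply/eqP.
  by rewrite eqEcard subsetT cardsT card_ord Sn /=.
move=> [closedS Si /andP[i0 iltn] ->]; split; last by exists S.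
- exact/(span_on_ideal _ natB).
- apply: contraTneq i0; rewrite -(span_on0 basisB) => /(span_on_inj basisB) S0.
  by rewrite -Si S0 cards0.
- apply: contraTneq iltn; rewrite -(span_onT basisB) => /(span_on_inj basisB) S1.
  by rewrite -Si S1 cardsT card_ord ltnn.
Qed.

(** All products lie in the span of the n squares, so if the algebra equals its
    square they span a space of dimension n. *)
Lemma perfect_free_squares B :
    natural_basis mul {:A} B -> perfect mul ->
  free [tuple mul (tnth B i) (tnth B i) | i < n].
Proof.
move=> natB perfA; set Q := [tuple _ | _ < _].
have mulQ x y : mul x y \in <<Q>>%VS.
  rewrite (mul_coordE x y natB); apply: memv_suml => i _.
  by apply/memvZ/memv_span/tnthP; exists i; rewrite tnth_mktuple.
have : basis_of {:A} Q.
  rewrite basisEdim size_tuple (size_basis natB.1) leqnn andbT.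
  apply/subvP => x _; have [s xs] := perfA x.
  by apply: subvP xs; apply/span_subvP => _ /mapP[p _ ->].
exact: basis_free.
Qed.

Lemma free_tnthP p (Q : p.-tuple A) (a : 'I_p -> K) :
  free Q -> \sum_i a i *: tnth Q i = 0 -> forall i, a i = 0.
Proof.
move=> /freeP freeQ aQ; apply: freeQ; rewrite -[RHS]aQ.
by apply: eq_bigr => i _; rewrite (tnth_nth 0).
Qed.

Lemma square_neq0 B i :
    natural_basis mul {:A} B -> perfect mul ->
  mul (tnth B i) (tnth B i) != 0.
Proof.
move=> natB /(perfect_free_squares natB) /free_not0; apply.
by apply/tnthP; exists i; rewrite tnth_mktuple.
Qed.

(** The squares e_i^2 being independent, the orthogonality of the vectors e'_j says
    that P j i * P k i = 0 for j != k, where P j i is the i-th coordinate of e'_j: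
    the supports of the e'_j are disjoint.  As there are n of them, and they are
    nonempty, each is a single index. *)
Lemma natural_basis_unique B B' :
    perfect mul -> natural_basis mul {:A} B -> natural_basis mul {:A} B' ->
  exists sigma c, (forall i, c i != 0) /\ B' = rescaled_basis B sigma c.
Proof.
move=> perfA natB [basisB' orthB'].
pose P j i := coord B i (tnth B' j).
have disjP j k i : j != k -> P j i * P k i = 0.
  move=> jk; apply: (free_tnthP (a := fun i => P j i * P k i)
                       (perfect_free_squares natB perfA)).
  rewrite -[RHS](orthB' _ _ jk) (mul_coordE _ _ natB).
  by apply: eq_bigr => l _; rewrite tnth_mktuple.
have /fin_all_exists[f fP] j : exists i, P j i != 0.
  apply/existsP; apply: contraNT (tnth_neq0 j basisB') => /existsPn Pj.
  rewrite (coordE (tnth B' j) natB.1) big1 // => i _.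
  by have /negPn/eqP := Pj i; rewrite /P => ->; rewrite scale0r.
have inj_f : injective f.
  move=> j k fjk; apply/eqP; apply: contraT => jk.
  have /eqP := disjP _ _ (f j) jk; rewrite mulf_eq0 (negPf (fP j)) fjk.
  by rewrite (negPf (fP k)).
exists (perm inj_f), (fun j => P j (f j)); split=> //.
apply: eq_from_tnth => j; rewrite tnth_mktuple permE.
rewrite {1}(coordE (tnth B' j) natB.1) (bigD1 (f j)) //= big1 ?addr0 // => i.
(* f is onto, so i is the index selected by some k, which is not j. *)
have [k ->] : exists k, i = f k.
  by exists ((perm inj_f)^-1%g i); rewrite -[RHS](permE inj_f) permKV.
rewrite (inj_eq inj_f) eq_sym => jk; have /eqP := disjP _ _ (f k) jk.
by rewrite mulf_eq0 (negPf (fP k)) orbF => /eqP; rewrite /P => ->; rewrite scale0r.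
Qed.

Lemma rescaled_natural B sigma c :
    (forall i, c i != 0) -> natural_basis mul {:A} B ->
  natural_basis mul {:A} (rescaled_basis B sigma c).
Proof.
move=> c0 natB; have [basisB orthB] := natB; split.
  rewrite basisEdim size_tuple (size_basis basisB) leqnn andbT.
  rewrite -(span_onT basisB); apply/span_subvP => _ /imageP[i _ ->].
  rewrite -(permKV sigma i); set j := (sigma^-1)%g i.
  rewrite -[tnth _ _](scalerK (c0 j)); apply/memvZ/memv_span/tnthP.
  by exists j; rewrite tnth_mktuple.
move=> i j ij; rewrite !tnth_mktuple linearZl_LR linearZr_LR /= orthB.
  by rewrite !scaler0.
by rewrite (inj_eq perm_inj).
Qed.

Lemma structure_mx_rescaled B sigma c k i :
    (forall i, c i != 0) -> natural_basis mul {:A} B ->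
  structure_mx mul (rescaled_basis B sigma c) k i =
    c i ^+ 2 / c k * structure_mx mul B (sigma k) (sigma i).
Proof.
move=> c0 natB; have natB' := rescaled_natural sigma c0 natB.
rewrite mxE tnth_mktuple linearZl_LR linearZr_LR /= (square_tnth _ natB) scalerA.
rewrite (reindex_inj (@perm_inj _ sigma)) /= scaler_sumr.
rewrite (eq_bigr (fun l => (c i ^+ 2 / c l
   * structure_mx mul B (sigma l) (sigma i)) *: tnth (rescaled_basis B sigma c) l)).
  by rewrite coord_sum_tnth //; case: natB'.
move=> l _; rewrite tnth_mktuple !scalerA; congr (_ *: _).
by rewrite [RHS]mulrAC divfK // expr2.
Qed.

Lemma closed_rescaled B sigma c S :
    (forall i, c i != 0) -> natural_basis mul {:A} B ->
  mx_closed (structure_mx mul (rescaled_basis B sigma c)) S <->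
  mx_closed (structure_mx mul B) (sigma @: S).
Proof.
move=> c0 natB; have natB' := rescaled_natural sigma c0 natB.
split=> [/(span_on_ideal _ natB') | /(span_on_ideal _ natB)] idS.
  by apply/(span_on_ideal _ natB); rewrite -(span_on_rescaled B _ _ c0).
by apply/(span_on_ideal _ natB'); rewrite span_on_rescaled.
Qed.

(** If A is the direct sum of I and J, each basis vector lies in I or in J: for
    e_i = u + v and k != i, the products u e_k and v e_k are opposite, hence both
    in I and J, hence 0; so u is a multiple of e_i.  If moreover e_i is in I and
    e_k is in J, then e_i^2 e_k = 0, so e_i^2 has no coordinate along e_k, which
    makes the indices of the vectors in I closed, and likewise for J. *)
Lemma reducibleE B :
    perfect mul -> natural_basis mul {:A} B ->
  let M := structure_mx mul B in
  reducible mul <->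
  exists S, [/\ mx_closed M S, mx_closed M (~: S), S != set0 & S != setT].
Proof.
move=> perfA natB M; have [basisB orthB] := natB; split; last first.
  move=> [S [closedS closedC S0 S1]]; exists (span_on B S), (span_on B (~: S)).
  split.
  - by split; apply/(span_on_ideal _ natB).
  - by rewrite -(span_on0 basisB) (inj_eq (span_on_inj basisB)).
  - rewrite -(span_on0 basisB) (inj_eq (span_on_inj basisB)).
    by apply: contra S1 => /eqP S1; rewrite -[S]setCK S1 setC0.
  - apply/vspaceP => x; rewrite memvf (coordE x basisB); apply: memv_suml.
    move=> i _; apply: memvZ; case: (boolP (i \in S)) => iS.
      by apply/(subvP (addvSl _ _)); rewrite tnth_span_on.
    by apply/(subvP (addvSr _ _)); rewrite tnth_span_on // inE.
  - apply/directv_addP/eqP; rewrite -subv0; apply/subvP => x /memv_capP[].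
    move=> /(mem_span_on _ _ basisB) xS /(mem_span_on _ _ basisB) xC.
    rewrite memv0 (coordE x basisB) big1 // => i _.
    case: (boolP (i \in S)) => [iS | /xS -> ]; last by rewrite scale0r.
    by rewrite xC ?scale0r // inE negbK.
move=> [I [J [[idI idJ] I0 J0 IJ /directv_addP IJ0]]].
have cap0 x : x \in I -> x \in J -> x = 0.
  by move=> xI xJ; apply/eqP; rewrite -memv0 -IJ0; apply/memv_capP.
have splitB i : tnth B i \in I \/ tnth B i \in J.
  have /memv_addP[u uI [v vJ uv]] : tnth B i \in (I + J)%VS by rewrite IJ memvf.
  have coord_u k : k != i -> coord B k u = 0.
    move=> ki; apply/eqP; move: (square_neq0 k natB perfA).
    rewrite -(mulr1 (coord _ _ _)) => sq0.
    suff: coord B k u *: mul (tnth B k) (tnth B k) == 0.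
      by rewrite scaler_eq0 (negPf sq0) orbF mulr1.
    rewrite -(mul_tnthr u k natB); apply/eqP/cap0.
      by case: (idI (tnth B k) _ uI).
    have /eqP : mul (tnth B i) (tnth B k) = 0 by rewrite orthB // eq_sym.
    rewrite uv linearDl /= addr_eq0 => /eqP ->.
    by rewrite rpredN; case: (idJ (tnth B k) _ vJ).
  have ua : u = coord B i u *: tnth B i.
    rewrite {1}(coordE u basisB) (bigD1 i) //= big1 ?addr0 // => k /coord_u ->.
    by rewrite scale0r.
  have [a0 | a0] := eqVneq (coord B i u) 0.
    by right; rewrite uv ua a0 scale0r add0r.
  by left; rewrite -[tnth B i](scalerK a0) -ua memvZ.
pose S := [set i | tnth B i \in I].
have SC i : i \in ~: S -> tnth B i \in J.
  by rewrite !inE => /negP; case: (splitB i).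
have sq_eq0 i k : mul (mul (tnth B i) (tnth B i)) (tnth B k) = 0 -> M k i = 0.
  move/eqP; rewrite (mul_tnthr _ _ natB) scaler_eq0.
  by rewrite (negPf (square_neq0 k natB perfA)) orbF mxE => /eqP.
exists S; split.
- move=> i k; rewrite [i \in _]inE -in_setC => iI /SC kJ; apply/sq_eq0/cap0.
    by apply: (idI _ _ _).2; apply: (idI _ _ _).2.
  by apply: (idJ _ _ _).1.
- move=> i k /SC iJ; rewrite !inE negbK => kI; apply/sq_eq0/cap0.
    by apply: (idI _ _ _).1.
  by apply: (idJ _ _ _).2; apply: (idJ _ _ _).2.
- apply: contra I0 => /eqP S0; rewrite -subv0; apply/subvP => x xI.
  rewrite memv0; apply/eqP/cap0 => //; rewrite (coordE x basisB).
  by apply: memv_suml => i _; apply/memvZ/SC; rewrite S0 setC0 inE.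
- apply: contra J0 => /eqP S1; rewrite -subv0; apply/subvP => x xJ.
  rewrite memv0; apply/eqP/cap0 => //; rewrite (coordE x basisB).
  apply: memv_suml => i _; apply/memvZ.
  by suff: i \in S; [rewrite inE | rewrite S1 inE].
Qed.

(** The trace on closed sets of the requirement that no basic ideal has dimension
    larger than s. *)
Definition size_maximal p (M : 'M[K]_p) (s : nat) : Prop :=
  forall S : {set 'I_p}, mx_closed M S -> (#|S| < p)%N -> (#|S| <= s)%N.

Lemma maximal_basic_ideal_relE B s I :
    natural_basis mul {:A} B ->
  let M := structure_mx mul B in
  maximal_basic_ideal_rel mul B s I <->
  (exists S, [/\ mx_closed M S, #|S| = s, (0 < s < n)%N & I = span_on B S])
  /\ size_maximal M s.
Proof.
move=> natB M; split=> [[basicI maxI] | [basicI maxM]].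
  split; first exact/(basic_ideal_relE _ _ natB).
  move=> S closedS Sn; rewrite leqNgt; apply/negP => sS.
  apply: (maxI _ (span_on B S) sS); apply/(basic_ideal_relE _ _ natB).
  by exists S; rewrite Sn (leq_ltn_trans _ sS).
split; first exact/(basic_ideal_relE _ _ natB).
move=> j J sj /(basic_ideal_relE _ _ natB)[S [closedS Sj /andP[_ jn] _]].
by have := maxM S closedS; rewrite Sj jn => /(_ isT); rewrite leqNgt sj.
Qed.

(** By uniqueness of the natural basis up to permutation and rescaling, basic
    ideals are the same for all natural bases. *)
Lemma maximal_basic_ideal_basis B s I :
    perfect mul -> natural_basis mul {:A} B ->
    maximal_basic_ideal_rel mul B s I ->
  maximal_basic_ideal mul s I.
Proof.
move=> perfA natB maxB n' B' natB'.
have nn' : n' = n by rewrite -(size_basis natB.1) -(size_basis natB'.1).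
case: _ / (esym nn') B' natB' => {n' nn'} B' natB'.
have [sigma [c [c0 defB']]] := natural_basis_unique perfA natB natB'.
have [[S [closedS Ss sn defI]] maxM] := (maximal_basic_ideal_relE _ _ natB).1 maxB.
apply/(maximal_basic_ideal_relE _ _ natB'); rewrite defB'; split.
  have sigmaK : sigma @: (sigma @^-1: S) = S.
    by apply/setP=> i; rewrite -(permKV sigma i) mem_imset ?inE //; apply: perm_inj.
  exists (sigma @^-1: S); split=> //.
  - by apply/(closed_rescaled _ _ c0 natB); rewrite sigmaK.
  - by rewrite -Ss -[in RHS]sigmaK card_imset //; apply: perm_inj.
  - by rewrite span_on_rescaled // sigmaK.
move=> T /(closed_rescaled _ _ c0 natB) closedT Tn.
rewrite -(card_imset _ (@perm_inj _ sigma)); apply: maxM => //.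
by rewrite card_imset //; apply: perm_inj.
Qed.

Lemma closed_setU p (M : 'M[K]_p) (S T : {set 'I_p}) :
  mx_closed M S -> mx_closed M T -> mx_closed M (S :|: T).
Proof.
move=> closedS closedT i k; rewrite !inE negb_or => /orP[] iX /andP[kS kT].
  exact: closedS.
exact: closedT.
Qed.

(** The union is closed; unless it is everything, maximality bounds its size by s,
    so it equals both sets. *)
Lemma maximal_closed_eq p (M : 'M[K]_p) s (S T : {set 'I_p}) :
    size_maximal M s -> mx_closed M S -> mx_closed M T ->
    #|S| = s -> #|T| = s -> S :|: T != setT ->
  T = S.
Proof.
move=> maxM closedS closedT Ss Ts ST.
have STs : (#|S :|: T| <= s)%N.
  apply: maxM; first exact: closed_setU.
  rewrite ltn_neqAle -[leqRHS]card_ord max_card andbT.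
  by apply: contra ST => /eqP STp; rewrite eqEcard subsetT cardsT card_ord STp /=.
have /eqP -> : T == S :|: T by rewrite eqEcard subsetUr Ts.
by apply/eqP; rewrite eq_sym eqEcard subsetUl Ss.
Qed.

(** Counting S and T against their union excludes the case where they cover all
    indices: if s = 1 there are too many indices, and if 2s = n the two sets are
    complementary and split the algebra. *)
Lemma maximal_closed_unique B s S T :
    perfect mul -> natural_basis mul {:A} B -> (2 < n)%N ->
  let M := structure_mx mul B in
    size_maximal M s -> mx_closed M S -> mx_closed M T ->
    #|S| = s -> #|T| = s -> s = 1%N \/ s.*2 = n /\ irreducible mul ->
  T = S.
Proof.
move=> perfA natB n2 M maxM closedS closedT Ss Ts cases.
apply: (maximal_closed_eq maxM) => //; apply/negP => /eqP STn.
have cardI : (n + #|S :&: T| = s + s)%N.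
  by rewrite -{1}Ss -Ts -cardsUI STn cardsT card_ord.
case: cases => [s1 | [s2n irrA]].
  by have := leq_trans n2 (leq_addr #|S :&: T| n); rewrite cardI s1.
have ST0 : S :&: T = set0.
  by apply/eqP; rewrite -cards_eq0 -(eqn_add2l n) cardI addn0 addnn s2n.
have defT : T = ~: S.
  apply/setP=> i; move/setP/(_ i): STn; move/setP/(_ i): ST0; rewrite !inE.
  by case: (i \in S) => //= ->.
apply: irrA; apply/(reducibleE perfA natB); exists S; split; rewrite -?defT //.
  by apply: contraTneq n2 => S0; rewrite -s2n -Ss S0 cards0.
apply: contraTneq n2 => S1; move: Ss; rewrite S1 cardsT card_ord => ns.
by move/eqP: s2n; rewrite -ns -addnn -[eqbRHS]addn0 eqn_add2l => /eqP ->.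
Qed.

(** Both parts of a splitting of the indices would have at most one element,
    against n > 2. *)
Lemma maximal1_irreducible B :
    perfect mul -> natural_basis mul {:A} B -> (2 < n)%N ->
    size_maximal (structure_mx mul B) 1 ->
  irreducible mul.
Proof.
move=> perfA natB n2 maxM /(reducibleE perfA natB)[S [closedS closedC S0 S1]].
have cardn : (#|S| + #|~: S| = n)%N by rewrite cardsC card_ord.
have S_gt0 : (0 < #|S|)%N by rewrite card_gt0.
have C_gt0 : (0 < #|~: S|)%N.
  by rewrite card_gt0; apply: contra S1 => /eqP C0; rewrite -[S]setCK C0 setC0.
have : (#|S| + #|~: S| <= 1 + 1)%N.
  apply: leq_add; [apply: (maxM S) | apply: (maxM (~: S))] => //.
    by rewrite -[leqRHS]cardn -[leqLHS]addn1 leq_add2l.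
  by rewrite -[leqRHS]cardn -[leqLHS]add1n leq_add2r.
by rewrite cardn leqNgt n2.
Qed.

End Evolution.

(** * Block structure matrices and their zeros *)

Section Blocks.
Variables (K : fieldType) (s m : nat).

Definition leading : {set 'I_(s + m)} := [set i : 'I_(s + m) | (i < s)%N].

Lemma leadingE : leading = lshift m @: [set: 'I_s].
Proof.
apply/setP=> i; rewrite inE; apply/idP/imsetP => [lt_is | [j _ ->]]; last exact: (ltn_ord j).
by exists (Ordinal lt_is) => //; apply: val_inj.
Qed.

Lemma leadingCE : ~: leading = @rshift s m @: [set: 'I_m].
Proof.
apply/setP=> i; rewrite !inE -leqNgt; apply/idP/imsetP => [le_si | [j _ ->]].
  have lt_im : (i - s < m)%N by rewrite ltn_subLR.
  by exists (Ordinal lt_im) => //; apply: val_inj; rewrite /= subnKC.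
exact: leq_addr.
Qed.

Lemma card_leading : #|leading| = s.
Proof. by rewrite leadingE card_imset ?cardsT ?card_ord //; apply: lshift_inj. Qed.

Lemma closed_leading (M : 'M[K]_(s + m)) :
  dlsubmx M = 0 <-> mx_closed M leading.
Proof.
split=> [M0 i k | closedM]; last first.
  apply/matrixP=> k i; rewrite dlsubmxEsub !mxE; apply: closedM.
    by rewrite leadingE imset_f.
  by rewrite -in_setC leadingCE imset_f.
rewrite -in_setC leadingCE leadingE => /imsetP[i' _ ->] /imsetP[k' _ ->].
by move/matrixP/(_ k' i'): M0; rewrite dlsubmxEsub !mxE.
Qed.

Definition zeros_on p (M : 'M[K]_p) (P Q : {set 'I_p}) : nat :=
  #|[set ij in setX P Q | M ij.1 ij.2 == 0]|.

Lemma num_zeros_mxsub p a b (M : 'M[K]_p) (f : 'I_a -> 'I_p) (g : 'I_b -> 'I_p) :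
    injective f -> injective g ->
  num_zeros (mxsub f g M) = zeros_on M (f @: setT) (g @: setT).
Proof.
move=> inj_f inj_g.
pose fg (ij : 'I_a * 'I_b) := (f ij.1, g ij.2).
have inj_fg : injective fg by move=> [i j] [i' j'] [/inj_f -> /inj_g ->].
rewrite /num_zeros /zeros_on -(card_imset _ inj_fg); congr #|pred_of_set _|.
apply/setP=> -[k l]; apply/imsetP/idP => [[[i j]] | ].
  by rewrite !inE mxE /= => Mij [-> ->] /=; rewrite !imset_f.
rewrite !inE /= => /andP[/andP[/imsetP[i _ ->] /imsetP[j _ ->]] Mij].
by exists (i, j); rewrite // inE mxE.
Qed.

Lemma zeros_on_perm p (M M' : 'M[K]_p) (sigma : 'S_p) (P Q : {set 'I_p}) :
    (forall k i, (M' k i == 0) = (M (sigma k) (sigma i) == 0)) ->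
  zeros_on M' P Q = zeros_on M (sigma @: P) (sigma @: Q).
Proof.
move=> M'E; pose ss (ij : 'I_p * 'I_p) := (sigma ij.1, sigma ij.2).
have inj_ss : injective ss.
  by move=> [i j] [i' j'] [/perm_inj -> /perm_inj ->].
rewrite /zeros_on -(card_imset _ inj_ss); congr #|pred_of_set _|.
apply/setP=> -[k l]; apply/imsetP/idP => [[[i j]] | ].
  by rewrite !inE M'E => /andP[/andP[iP jQ] Mij] [-> ->] /=; rewrite !imset_f.
rewrite !inE /= => /andP[/andP[/imsetP[i iP ->] /imsetP[j jQ ->]] Mij].
by exists (i, j); rewrite // !inE M'E /= iP jQ.
Qed.

Variables (A : vectType K) (mul : {bilinear A -> A -> A}).
Implicit Types (B : (s + m).-tuple A) (I : {vspace A}).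

(** The point beyond unfolding is that the coordinates, relative to the first s
    vectors, of an element of their span are its first s coordinates relative to
    the whole basis. *)
Lemma leading_adapted B :
    natural_basis mul {:A} B -> is_ideal mul (span_on B leading) ->
  let M := structure_mx mul B in
  adapted_basis mul (span_on B leading) B (ulsubmx M) (ursubmx M) (drsubmx M).
Proof.
move=> natB idF M; have [basisB orthB] := natB.
have closedF := (span_on_ideal _ natB).1 idF.
have subF : {subset first_tuple B <= span_on B leading}.
  move=> _ /tnthP[i ->]; rewrite tnth_mktuple tnth_span_on //.
  by rewrite leadingE imset_f.
have minF (J : {vspace A}) : {subset first_tuple B <= J} -> (span_on B leading <= J)%VS.
  move=> subJ; apply/span_subvP => x /imageP[k].
  rewrite leadingE => /imsetP[i _ ->] ->; apply: subJ.
  by apply/tnthP; exists i; rewrite tnth_mktuple.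
have spanF : <<first_tuple B>>%VS = span_on B leading.
  apply: subv_anti; rewrite minF; last exact: memv_span.
  by rewrite andbT; apply/span_subvP.
(* Extend a relation on the first s vectors by zero to the whole basis. *)
have freeF : free (first_tuple B).
  apply/freeP => a a0 i; pose b (j : 'I_(s + m)) := if split j is inl l then a l else 0.
  have <- : b (lshift m i) = a i by rewrite /b (unsplitK (inl i)).
  rewrite -(coord_sum_tnth b _ basisB) big_split_ord /=.
  rewrite [X in _ + X]big1 => [|j _]; last by rewrite /b (unsplitK (inr j)) scale0r.
  rewrite addr0 (_ : \sum_j _ = 0) ?linear0 // -[RHS]a0; apply: eq_bigr => j _.
  by rewrite /b (unsplitK (inl j)) -tnth_nth tnth_mktuple.
have basisF : basis_of (span_on B leading) (first_tuple B).
  by rewrite basisEfree freeF spanF subvv -spanF dim_span.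
split.
- split=> //; rewrite -[LHS]submxK; congr block_mx.
  exact/closed_leading.
- by split=> // J _ /minF.
- by split=> // i j ij; rewrite !tnth_mktuple orthB //.
- apply/matrixP=> k i; rewrite ulsubmxEsub !mxE !tnth_mktuple.
  set x := mul _ _; have xF : x \in span_on B leading.
    apply: (idF _ _ _).1; apply: subF.
    by apply/tnthP; exists i; rewrite tnth_mktuple.
  rewrite {1}(coord_basis basisF xF).
  transitivity (coord B (lshift m k) (\sum_j coord (first_tuple B) j x *: tnth B (lshift m j))).
    by congr (coord _ _ _); apply: eq_bigr => j _; rewrite -tnth_nth tnth_mktuple.
  rewrite linear_sum (bigD1 k) //= linearZ /= coord_tnth // eqxx mulr1.
  rewrite big1 ?addr0 // => j jk; rewrite linearZ /= coord_tnth //.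
  by rewrite eq_lshift eq_sym (negPf jk) mulr0.
Qed.

Lemma exists_adapted_basis B I :
    natural_basis mul {:A} B -> basic_ideal_rel mul B s I ->
  exists (B' : (s + m).-tuple A) W U Y, adapted_basis mul I B' W U Y.
Proof.
move=> natB [idI _ _ [S [Ss defI]]].
have size_st : size (enum S ++ enum (~: S)) == (s + m)%N.
  by rewrite size_cat -!cardE cardsC card_ord.
have inj_st : injective (tnth (Tuple size_st)).
  apply/tuple_uniqP; rewrite cat_uniq !enum_uniq andbT /=.
  by apply/hasPn=> i; rewrite !mem_enum inE.
(* List the indices in S first, then the others. *)
pose sigma := perm inj_st.
have sigmaF : sigma @: leading = S.
  apply/eqP; rewrite eqEcard card_imset; last exact: perm_inj.
  rewrite card_leading Ss leqnn andbT; apply/subsetP => _ /imsetP[i iF ->].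
  rewrite inE in iF.
  rewrite permE (tnth_nth i) nth_cat -cardE Ss iF -mem_enum mem_nth //.
  by rewrite -cardE Ss.
have natB' := rescaled_natural sigma (fun=> oner_neq0 K) natB.
have IE : I = span_on (rescaled_basis B sigma (fun=> 1)) leading.
  by rewrite span_on_rescaled ?sigmaF // => i; apply: oner_neq0.
rewrite IE in idI *.
exists (rescaled_basis B sigma (fun=> 1)).
by do 3 eexists; apply: leading_adapted.
Qed.

Lemma block_basis_closed B W U Y :
    block_basis mul B W U Y ->
  mx_closed (structure_mx mul B) leading.
Proof. by move=> [_ defM]; apply/closed_leading; rewrite defM block_mxKdl. Qed.

(** A second basis in block form is a permutation and rescaling of the first one;
    the permutation carries the leading indices to a closed set with s elements,
    so it stabilises them, and the blocks correspond. *)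
Lemma zeros_invariant_leading B W U Y :
    perfect mul -> block_basis mul B W U Y ->
    (forall T, mx_closed (structure_mx mul B) T -> #|T| = s -> T = leading) ->
  zeros_invariant mul W U Y.
Proof.
move=> perfA [natB defM] uniqF.
suff key (B' : (s + m).-tuple A) W' U' Y' : block_basis mul B' W' U' Y' ->
    [/\ num_zeros W' = num_zeros W, num_zeros U' = num_zeros U
      & num_zeros Y' = num_zeros Y].
  by split=> B' W' U' Y' /key[].
move=> blockB'; have [natB' defM'] := blockB'.
have [sigma [c [c0 defB']]] := natural_basis_unique perfA natB natB'.
have sigmaF : sigma @: leading = leading.
  apply: uniqF; last by rewrite card_imset ?card_leading //; apply: perm_inj.
  by apply/(closed_rescaled _ _ c0 natB); rewrite -defB'; apply: block_basis_closed blockB'.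
have sigmaC : sigma @: (~: leading) = ~: leading.
  apply/eqP; rewrite eqEcard card_imset ?leqnn ?andbT; last exact: perm_inj.
  apply/subsetP=> _ /imsetP[i iF ->]; move: iF; rewrite !in_setC.
  by rewrite -{2}sigmaF mem_imset //; apply: perm_inj.
have zeroM k i : (structure_mx mul B' k i == 0) =
    (structure_mx mul B (sigma k) (sigma i) == 0).
  rewrite defB' structure_mx_rescaled // mulf_eq0 mulf_eq0 invr_eq0.
  by rewrite expf_eq0 (negPf (c0 i)) (negPf (c0 k)).
have -> : W' = ulsubmx (structure_mx mul B') by rewrite defM' block_mxKul.
have -> : U' = ursubmx (structure_mx mul B') by rewrite defM' block_mxKur.
have -> : Y' = drsubmx (structure_mx mul B') by rewrite defM' block_mxKdr.
have -> : W = ulsubmx (structure_mx mul B) by rewrite defM block_mxKul.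
have -> : U = ursubmx (structure_mx mul B) by rewrite defM block_mxKur.
have -> : Y = drsubmx (structure_mx mul B) by rewrite defM block_mxKdr.
rewrite !ulsubmxEsub !ursubmxEsub !drsubmxEsub.
rewrite !num_zeros_mxsub; do ?[exact: lshift_inj | exact: rshift_inj].
by rewrite -!leadingE -!leadingCE !(zeros_on_perm _ _ zeroM) sigmaF sigmaC.
Qed.

Lemma permuted_block_leading B (sigma : 'S_(s + m)) :
    natural_basis mul {:A} B ->
    (forall T, mx_closed (structure_mx mul B) T -> #|T| = s -> T = leading) ->
    dlsubmx (structure_mx mul (permuted_basis B sigma)) = 0 ->
  sigma @: leading = leading.
Proof.
move=> natB uniqF /closed_leading; rewrite permuted_basisE => closedF.
apply: uniqF; last by rewrite card_imset ?card_leading //; apply: perm_inj.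
by apply/(closed_rescaled sigma leading (fun=> oner_neq0 K) natB).
Qed.

End Blocks.

(** * The evolution algebra with a given structure matrix *)

Section MatrixAlgebra.
Variables (K : fieldType) (n : nat) (M : 'M[K]_n).

Definition evo_mul (x y : 'rV[K]_n) : 'rV[K]_n :=
  (\row_i (x 0 i * y 0 i)) *m M^T.

Lemma evo_mul_bilinear : bilinear_for *:%R *:%R evo_mul.
Proof.
split=> [y a u v | x a u v]; rewrite /= /evo_mul scalemxAl -mulmxDl.
  by congr (_ *m _); apply/rowP=> i; rewrite !mxE mulrDl mulrA.
by congr (_ *m _); apply/rowP=> i; rewrite !mxE mulrDr mulrCA.
Qed.

HB.instance Definition _ :=
  bilinear_isBilinear.Build K 'rV[K]_n 'rV[K]_n 'rV[K]_n *:%R *:%R evo_mul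
    evo_mul_bilinear.

Definition standard_basis : n.-tuple 'rV[K]_n := [tuple delta_mx 0 i | i < n].

Lemma standard_basis_of : basis_of {:'rV[K]_n} standard_basis.
Proof.
rewrite basisEdim size_tuple dimvf /dim /= mul1n leqnn andbT.
apply/subvP=> x _; rewrite (row_sum_delta x); apply: memv_suml => i _.
apply/memvZ/memv_span; rewrite -(tnth_mktuple (fun j => delta_mx 0 j) i).
exact: mem_tnth.
Qed.

Lemma coord_standard x i : coord standard_basis i x = x 0 i.
Proof.
rewrite {1}(row_sum_delta x) -[RHS](coord_sum_tnth _ i standard_basis_of).
by congr (coord _ _ _); apply: eq_bigr => j _; rewrite tnth_mktuple.
Qed.

Lemma evo_mul_delta i j :
  evo_mul (delta_mx 0 i) (delta_mx 0 j) = (i == j)%:R *: row i M^T.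
Proof.
rewrite rowE scalemxAl; congr (_ *m _); apply/rowP=> k; rewrite !mxE eqxx /=.
by rewrite [k == j]eq_sym; case: eqP => [-> | _]; rewrite ?mul0r ?mulr0 // mul1r mulr1 eq_sym.
Qed.

Lemma standard_natural : natural_basis evo_mul {:'rV[K]_n} standard_basis.
Proof.
split=> [|i j ij]; first exact: standard_basis_of.
by rewrite !tnth_mktuple /= evo_mul_delta (negPf ij) scale0r.
Qed.

Lemma structure_mx_standard : structure_mx evo_mul standard_basis = M.
Proof.
apply/matrixP=> k i; rewrite mxE coord_standard tnth_mktuple /= evo_mul_delta.
by rewrite eqxx scale1r !mxE.
Qed.

Lemma evo_mul_perfect : M \in unitmx -> perfect evo_mul.
Proof.
move=> unitM x; pose d i : 'rV[K]_n * 'rV[K]_n := (delta_mx 0 i, delta_mx 0 i).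
exists [seq d i | i : 'I_n].
rewrite -[x](@mulmxKV _ _ _ M^T) ?unitmx_tr // mulmx_sum_row.
apply: memv_suml => i _; apply/memvZ/memv_span/mapP.
exists (d i); first exact: image_f.
by rewrite /= evo_mul_delta eqxx scale1r.
Qed.

End MatrixAlgebra.

(** * A reducible algebra whose zero counts are not invariant *)

Section Reducible.
Variable K : fieldType.

Definition swap_halves_fun h (i : 'I_(h + h)) : 'I_(h + h) :=
  match split i with inl j => rshift h j | inr j => lshift h j end.

Lemma swap_halvesK h : involutive (@swap_halves_fun h).
Proof.
move=> i; rewrite -[i]splitK /swap_halves_fun.
by case: (split i) => j /=; rewrite ?(unsplitK (inl j)) ?(unsplitK (inr j))
  ?(unsplitK (inl j)) ?(unsplitK (inr j)).
Qed.

Definition swap_halves h : 'S_(h + h) := perm (inv_inj (@swap_halvesK h)).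

Lemma swap_halves_lshift h (j : 'I_h) : swap_halves h (lshift h j) = rshift h j.
Proof. by rewrite permE /swap_halves_fun (unsplitK (inl j)). Qed.

Lemma swap_halves_rshift h (j : 'I_h) : swap_halves h (rshift h j) = lshift h j.
Proof. by rewrite permE /swap_halves_fun (unsplitK (inr j)). Qed.

Lemma block_basis_swap (A : vectType K) (mul : {bilinear A -> A -> A}) h
    (B : (h + h).-tuple A) (W Y : 'M[K]_h) :
    block_basis mul B W 0 Y ->
  block_basis mul (permuted_basis B (swap_halves h)) Y 0 W.
Proof.
move=> [natB defM]; rewrite permuted_basisE.
have c0 (i : 'I_(h + h)) : (fun=> 1 : K) i != 0 by apply: oner_neq0.
split; first exact: rescaled_natural.
apply/matrixP=> k i; rewrite structure_mx_rescaled // defM expr1n divr1 mul1r.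
rewrite -[k]splitK -[i]splitK.
case: (split k) (split i) => k' [] i' /=;
  rewrite ?swap_halves_lshift ?swap_halves_rshift.
- by rewrite block_mxEdr block_mxEul.
- by rewrite block_mxEdl block_mxEur !mxE.
- by rewrite block_mxEur block_mxEdl !mxE.
- by rewrite block_mxEul block_mxEdr.
Qed.

Definition antidiag : 'M[K]_2 := \matrix_(i, j) (i != j)%:R.

(** The invertible 2 x 2 matrix with rows (1, 1) and (1, 0).  Like [antidiag] it has
    nonzero off-diagonal entries, so that neither summand contains a 1-dimensional
    basic ideal, and its determinant -1 is a unit in every characteristic. *)
Definition fibonacci : 'M[K]_2 := \matrix_(i, j) ((i == 0) || (j == 0))%:R.
Definition example_mx : 'M[K]_(2 + 2) := block_mx antidiag 0 0 fibonacci.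

Lemma example_unit : example_mx \in unitmx.
Proof.
rewrite unitmxE det_ublock unitrM -!unitmxE; apply/andP; split.
  have : antidiag *m antidiag = 1%:M.
    apply/matrixP=> -[[|[|//]] ?] [[|[|//]] ?]; rewrite mxE !big_ord_recl big_ord0;
      by rewrite !mxE /= ?mulr0 ?mul0r ?mulr1 ?add0r ?addr0.
  by case/mulmx1_unit.
(* The inverse of [fibonacci], with rows (0, 1) and (1, -1). *)
pose N : 'M[K]_2 := \matrix_(i, j) (if i == j then - (i != 0)%:R else 1).
have : fibonacci *m N = 1%:M.
  apply/matrixP=> -[[|[|//]] ?] [[|[|//]] ?]; rewrite mxE !big_ord_recl big_ord0;
    by rewrite !mxE /= ?mulr0 ?mul0r ?mulr1 ?oppr0 ?add0r ?addr0 ?mulr0 ?mul1r ?subrr ?add0r.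
by case/mulmx1_unit.
Qed.

Lemma num_zerosE p q (M : 'M[K]_(p, q)) :
  num_zeros M = (\sum_i \sum_j (M i j == 0%R))%N.
Proof.
rewrite pair_bigA /num_zeros -sum1_card big_mkcond; apply: eq_bigr => ij _.
by rewrite inE; case: (_ == _).
Qed.

Lemma num_zeros_antidiag : num_zeros antidiag = 2.
Proof.
rewrite num_zerosE !big_ord_recl !big_ord0 !mxE /=.
by rewrite ?eqxx ?oner_eq0.
Qed.

Lemma num_zeros_fibonacci : num_zeros fibonacci = 1.
Proof.
rewrite num_zerosE !big_ord_recl !big_ord0 !mxE /=.
by rewrite ?eqxx ?oner_eq0.
Qed.

(** The digraph of the example consists of two strongly connected pairs of indices,
    so a closed set is a union of these pairs and cannot have 3 elements. *)
Lemma example_size_maximal : size_maximal example_mx 2.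
Proof.
move=> S closedS.
have arrow i k : example_mx k i != 0 -> i \in S -> k \in S.
  by move=> Mki iS; apply: contraNT Mki => kS; apply/eqP/closedS.
have inl01 : (lshift 2 ord0 \in S) = (lshift 2 (lift ord0 ord0) \in S).
  by apply/idP/idP; apply: arrow; rewrite block_mxEul mxE oner_eq0.
have inr01 : (rshift 2 ord0 \in S) = (rshift 2 (lift ord0 ord0) \in S).
  by apply/idP/idP; apply: arrow; rewrite block_mxEdr mxE oner_eq0.
rewrite -sum1_card big_mkcond big_split_ord !big_ord_recl !big_ord0 /=.
by rewrite -inl01 -inr01; do 2 case: (_ \in S).
Qed.
End Reducible.

Lemma reducible_example (K : fieldType) :
  exists (h : nat) (A : vectType K) (mul : {bilinear A -> A -> A})
      (I : {vspace A}) (B : (h + h).-tuple A) (W U Y : 'M[K]_h),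
    (3 <= h + h)%N /\ \dim {:A} = (h + h)%N /\
    evolution_algebra mul /\ perfect mul /\ reducible mul /\
    maximal_basic_ideal mul h I /\
    adapted_basis mul I B W U Y /\
    ~ zeros_invariant mul W U Y.
Proof.
pose mul : {bilinear _ -> _ -> _} := evo_mul (example_mx K).
pose B := standard_basis K (2 + 2).
have natB : natural_basis mul {:_} B := standard_natural _.
have perfA : perfect mul := evo_mul_perfect (example_unit K).
have strB : structure_mx mul B = example_mx K := structure_mx_standard _.
have closedF : mx_closed (structure_mx mul B) (leading 2 2).
  by apply/closed_leading; rewrite strB block_mxKdl.
have idF := (span_on_ideal _ natB).2 closedF.
have adaptedB := leading_adapted natB idF.
rewrite strB /example_mx block_mxKul block_mxKur block_mxKdr in adaptedB.
exists 2, 'rV[K]_(2 + 2), mul, (span_on B (leading 2 2)), B.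
exists (antidiag K), 0, (fibonacci K).
split=> //; split; first by rewrite (size_basis natB.1).
split; first by exists (2 + 2)%N, B.
split=> //; split; last split.
- apply/(reducibleE perfA natB); exists (leading 2 2); split=> //.
  + rewrite strB => i k; rewrite [k \in _]in_setC negbK leadingCE => /imsetP[i' _ ->].
    rewrite leadingE => /imsetP[k' _ ->].
    by rewrite block_mxEur mxE.
  + by rewrite -card_gt0 card_leading.
  + apply/eqP=> FT; have := card_leading 2 2.
    by rewrite FT cardsT card_ord.
- apply: (maximal_basic_ideal_basis perfA natB).
  apply/(maximal_basic_ideal_relE _ _ natB); split.
    by exists (leading 2 2); rewrite card_leading.
  by rewrite strB; apply: example_size_maximal.
split=> // -[+ _ _]; have [blockB _ _ _] := adaptedB.
move=> /(_ _ _ _ _ (block_basis_swap blockB)).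
by rewrite num_zeros_antidiag num_zeros_fibonacci.
Qed.

(** * The theorem *)

Theorem proposition2p15 (K : fieldType) :
  (forall (A : vectType K) (mul : {bilinear A -> A -> A}) (n s : nat)
      (I : {vspace A}),
    (3 <= n)%N -> \dim {:A} = n ->
    evolution_algebra mul -> perfect mul ->
    maximal_basic_ideal mul s I ->
    s = 1%N \/ s.*2 = n ->
    (exists (B : (s + (n - s)).-tuple A) (W : 'M[K]_s)
        (U : 'M[K]_(s, n - s)) (Y : 'M[K]_(n - s)),
      adapted_basis mul I B W U Y) /\
    (forall (B : (s + (n - s)).-tuple A) (W : 'M[K]_s)
        (U : 'M[K]_(s, n - s)) (Y : 'M[K]_(n - s)),
      adapted_basis mul I B W U Y ->
      [/\ (* i *)
          s = 1%N ->
            irreducible mul /\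
            forall sigma : 'S_(s + (n - s)),
              dlsubmx (structure_mx mul (permuted_basis B sigma)) = 0 ->
              forall i : 'I_(s + (n - s)),
                i = 0%N :> nat -> sigma i = 0%N :> nat,
          (* ii *)
          s = 1%N -> zeros_invariant mul W U Y,
          (* iii *)
          s.*2 = n -> irreducible mul ->
            forall sigma : 'S_(s + (n - s)),
              dlsubmx (structure_mx mul (permuted_basis B sigma)) = 0 ->
              (forall i : 'I_(s + (n - s)), (i < s)%N -> (sigma i < s)%N) /\
              (forall j : 'I_(s + (n - s)), (s <= j)%N -> (s <= sigma j)%N)
        & (* iv *)
          s.*2 = n -> irreducible mul -> zeros_invariant mul W U Y])) /\
  (* iv, failure in the reducible case *)
  (2%N \notin [pchar K] ->
    exists (h : nat) (A : vectType K) (mul : {bilinear A -> A -> A})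
        (I : {vspace A}) (B : (h + h).-tuple A) (W U Y : 'M[K]_h),
      (3 <= h + h)%N /\ \dim {:A} = (h + h)%N /\
      evolution_algebra mul /\ perfect mul /\ reducible mul /\
      maximal_basic_ideal mul h I /\
      adapted_basis mul I B W U Y /\
      ~ zeros_invariant mul W U Y).
Proof.
split; last by move=> _; apply: reducible_example.
move=> A mul n s I n3 dimA [n0 [B0 natB0]] perfA maxI s_cases.
have [[_ [_ _ /andP[s_gt0 s_lt_n0] _]] _] :=
  (maximal_basic_ideal_relE s I natB0).1 (maxI _ _ natB0).
have n0n : n0 = n by rewrite -dimA (size_basis natB0.1).
have nE : n = (s + (n - s))%N by rewrite subnKC // -n0n ltnW.
have {n0 n0n s_lt_n0 B0 natB0} [B0 natB0] :
    exists B0 : (s + (n - s)).-tuple A, natural_basis mul {:A} B0.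
  by rewrite -nE; case: _ / n0n B0 natB0 => B0 natB0; exists B0.
move: (n - s)%N nE B0 natB0 => m nE B0 natB0; rewrite nE in n3 s_cases *.
split; first exact: exists_adapted_basis natB0 (maxI _ _ natB0).1.
move=> B W U Y [blockB _ _ _]; have [natB _] := blockB.
have [_ maxM] := (maximal_basic_ideal_relE s I natB).1 (maxI _ _ natB).
have closedF := block_basis_closed blockB.
have uniqF : s = 1%N \/ s.*2 = (s + m)%N /\ irreducible mul ->
    forall T, mx_closed (structure_mx mul B) T -> #|T| = s -> T = leading s m.
  move=> cases T closedT cardT.
  exact: (maximal_closed_unique perfA natB n3 maxM closedF closedT
            (card_leading s m) cardT cases).
have leadP (sigma : 'S_(s + m)) : sigma @: leading s m = leading s m ->
    forall i, (sigma i < s)%N = (i < s)%N.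
  move=> sigmaF i; have := mem_imset (leading s m) i (@perm_inj _ sigma).
  by rewrite sigmaF !inE.
split.
- move=> s1; split.
    by apply: (maximal1_irreducible perfA natB n3); rewrite -[X in size_maximal _ X]s1.
  move=> sigma dl0 i i0.
  have := leadP _ (permuted_block_leading natB (uniqF (or_introl s1)) dl0) i.
  rewrite i0 s_gt0 => sigma_i.
  by apply/eqP; rewrite -leqn0 -ltnS; apply: leq_trans sigma_i (eq_leq s1).
- by move=> s1; apply: zeros_invariant_leading (uniqF (or_introl s1)).
- move=> s2n irrA sigma dl0.
  have lead := leadP _ (permuted_block_leading natB
                 (uniqF (or_intror (conj s2n irrA))) dl0).
  by split=> i; rewrite ?(leqNgt s) lead.
- move=> s2n irrA.
  exact: zeros_invariant_leading (uniqF (or_intror (conj s2n irrA))).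
Qed.
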